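(* Let $\Omega\subset\mathbb{R}^n$ be closed, let $\mathbf{b}\in\mathbb{R}^n$, and let $\mathbf{A}$ be a function that maps each $\mathbf{x}\in\Omega$ to an invertible matrix $\mathbf{A}(\mathbf{x})\in\mathbb{R}^{n\times n}$. Assume that the function $\mathbf{x}\mapsto \mathbf{A}^{-1}(\mathbf{x})\mathbf{b}$ maps $\Omega$ into $\Omega$ and is Lipschitz continuous on $\Omega$ with Lipschitz constant $L<1$, so that it has a unique fixed point $\mathbf{x}^*\in\Omega$. Assume furthermore that the condition number $\kappa(\mathbf{A}(\mathbf{x}))$ is bounded on $\Omega$. Let $0<\tau_r<1$ and let $(\mathbf{x}^k)_{k\ge 0}$ be a sequence in $\Omega$ satisfying, for every $k\ge 0$, $$\|\mathbf{A}(\mathbf{x}^k)\mathbf{x}^{k+1}-\mathbf{b}\|\le \tau_r\,\|\mathbf{A}(\mathbf{x}^k)\mathbf{x}^{k}-\mathbf{b}\|,$$ and assume that this sequence converges to a limit $\mathbf{x}_\epsilon$. Then $\mathbf{x}_\epsilon=\mathbf{x}^*$, independently of the choice of $\tau_r$.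
   Context: $\|\cdot\|$ denotes a norm on $\mathbb{R}^n$ and also the induced matrix norm on $\mathbb{R}^{n\times n}$. $\mathbf{A}^{-1}(\mathbf{x})$ denotes the inverse matrix $(\mathbf{A}(\mathbf{x}))^{-1}$, and $\kappa(\mathbf{A}(\mathbf{x}))=\|\mathbf{A}(\mathbf{x})\|\,\|\mathbf{A}^{-1}(\mathbf{x})\|$ is the condition number. The sequence $(\mathbf{x}^k)$ is the inexact Picard iteration: at each step the linear system $\mathbf{A}(\mathbf{x}^k)\mathbf{x}^{k+1}=\mathbf{b}$ is solved for $\mathbf{x}^{k+1}$ only approximately, until the displayed relative termination criterion with relative tolerance $\tau_r$ holds. No continuity of the map $\mathbf{x}\mapsto\mathbf{A}(\mathbf{x})$ is assumed. *)

(* Defs.v *)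
From HB Require Import structures.
From mathcomp Require Import all_boot all_order all_algebra.
From mathcomp Require Import all_classical all_reals all_analysis.

Set Implicit Arguments.
Unset Strict Implicit.
Unset Printing Implicit Defensive.

Import Order.TTheory GRing.Theory Num.Theory.
Import numFieldNormedType.Exports.

Local Open Scope classical_set_scope.
Local Open Scope ring_scope.

(* The library equips ['cV[R]_n] with one fixed norm, the maximum norm; an
   arbitrary norm on R^n is therefore a function [N] satisfying the axioms
   below (nonnegativity follows from them). The library topology on ['cV[R]_n]
   is the usual one, which every norm on R^n induces. *)
Definition is_norm (R : realType) (n : nat) (N : 'cV[R]_n -> R) : Prop :=
  [/\ forall x, N x = 0 -> x = 0,
      forall (a : R) x, N (a *: x) = `|a| * N x
    & forall x y, N (x + y) <= N x + N y].

(* The set below is nonempty and bounded above whenever [N] is a norm, so the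
   total real-valued [sup] is then its least upper bound. *)
Definition induced_norm (R : realType) (n : nat) (N : 'cV[R]_n -> R)
    (M : 'M[R]_n) : R :=
  sup [set N (M *m x) | x in [set x | N x <= 1]].

Definition cond_number (R : realType) (n : nat) (N : 'cV[R]_n -> R)
    (M : 'M[R]_n) : R :=
  induced_norm N M * induced_norm N (invmx M).

(* The library's [k.-lipschitz_A f] only refers to the built-in norm. *)
Definition lipschitz_wrt (R : realType) (n : nat) (N : 'cV[R]_n -> R) (L : R)
    (Omega : set 'cV[R]_n) (f : 'cV[R]_n -> 'cV[R]_n) : Prop :=
  forall x y, Omega x -> Omega y -> N (f x - f y) <= L * N (x - y).

Definition picard (R : realType) (n : nat) (A : 'cV[R]_n -> 'M[R]_n)
    (b : 'cV[R]_n) (x : 'cV[R]_n) : 'cV[R]_n :=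
  invmx (A x) *m b.

Definition inexact_picard_seq (R : realType) (n : nat) (N : 'cV[R]_n -> R)
    (A : 'cV[R]_n -> 'M[R]_n) (b : 'cV[R]_n) (tau : R)
    (x : nat -> 'cV[R]_n) : Prop :=
  forall k, N (A (x k) *m x k.+1 - b) <= tau * N (A (x k) *m x k - b).

(* Main.v *)
(* Write f x = A(x)^-1 b. One inexact step controls the displacement of the
   current iterate: since A(x^k)(x^k - f x^k) = A(x^k) x^k - b, the termination
   criterion gives
     |x^k - f x^k| <= kappa(A(x^k)) / (1 - tau) * |x^(k+1) - x^k|.
   Along a convergent sequence the right-hand side tends to 0 because kappa is
   bounded, and f is continuous, so the limit is a fixed point of f. Continuity
   of A itself plays no role. *)

Require Import Defs.
From HB Require Import structures.
From mathcomp Require Import all_boot all_order all_algebra.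
From mathcomp Require Import all_classical all_reals all_analysis.
From mathcomp Require Import ring lra.

Set Implicit Arguments.
Unset Strict Implicit.
Unset Printing Implicit Defensive.

Import Order.TTheory GRing.Theory Num.Theory.
Import numFieldNormedType.Exports.

Local Open Scope classical_set_scope.
Local Open Scope ring_scope.

(** * Elementary consequences of the norm axioms *)

Section NormFacts.
Context (R : realType) (n : nat) (N : 'cV[R]_n -> R) (N_norm : is_norm N).

Lemma is_norm0 : N 0 = 0.
Proof. by case: N_norm => _ NZ _; rewrite -(scale0r 0) NZ normr0 mul0r. Qed.

Lemma is_normN x : N (- x) = N x.
Proof. by case: N_norm => _ NZ _; rewrite -scaleN1r NZ normrN1 mul1r. Qed.

Lemma is_norm_ge0 x : 0 <= N x.
Proof.
case: N_norm => _ _ /(_ x (- x)).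
by rewrite subrr is_norm0 is_normN -mulr2n pmulrn_lge0.
Qed.

Lemma is_norm_distC x y : N (x - y) = N (y - x).
Proof. by rewrite -is_normN opprB. Qed.

Lemma is_norm_distD z x y : N (x - y) <= N (x - z) + N (z - y).
Proof. by case: N_norm => _ _ /(_ (x - z) (z - y)); rewrite subrKA. Qed.

Lemma is_norm_eq x y : N (x - y) <= 0 -> x = y.
Proof.
case: N_norm => N0 _ _ xy0; apply/eqP; rewrite -subr_eq0; apply/eqP/N0/eqP.
by rewrite eq_le xy0 is_norm_ge0.
Qed.

End NormFacts.

(** * Equivalence of an arbitrary norm with the maximum norm *)

Lemma le_coord_mx_norm (R : realType) (m n : nat) (x : 'M[R]_(m, n)) i j :
  `|x i j| <= `|x|.
Proof.
rewrite [leRHS]/Num.norm /= mx_normrE.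
exact: (le_bigmax _ (fun ij : 'I_m * 'I_n => `|x ij.1 ij.2|) (i, j)).
Qed.

(** Expand [x] in the standard basis: each coordinate is at most [|x|], so the sum of the norms of
    the basis vectors serves as constant. Adding 1 keeps it positive even for [n = 0]. *)
Lemma is_norm_le_mx_norm (R : realType) (n : nat) (N : 'cV[R]_n -> R) :
  is_norm N -> exists2 C, 0 < C & forall x, N x <= C * `|x|.
Proof.
move=> N_norm; have [_ NZ ND] := N_norm.
have N0 := is_norm_ge0 N_norm.
exists (1 + \sum_i N (delta_mx i 0)).
  by rewrite ltr_wpDr// sumr_ge0.
move=> x; rewrite [x in N x]matrix_sum_delta.
under eq_bigr do rewrite big_ord1.
apply: (@le_trans _ _ (\sum_i `|x| * N (delta_mx i 0))); last first.
  by rewrite -mulr_sumr mulrC ler_wpM2r// lerDr.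
apply: (big_ind2 (fun u a => N u <= a)) => [|u a v c au cv|i _].
- by rewrite (is_norm0 N_norm).
- exact: le_trans (ND _ _) (lerD au cv).
- by rewrite NZ ler_wpM2r// le_coord_mx_norm.
Qed.

Lemma lipschitz_on_within_continuous (R : realType) (n : nat)
    (K : set 'cV[R]_n) (g : 'cV[R]_n -> R) (C : R) :
  (forall x y, K x -> K y -> `|g x - g y| <= C * `|x - y|) ->
  {within K, continuous g}.
Proof.
move=> gC; apply/subspace_continuousP => x Kx; apply/cvgrPdist_lt => e e0.
(* [C] may be zero or negative; [M] dominates it and is safe to divide by. *)
pose M := `|C| + 1; have M0 : 0 < M by rewrite ltr_wpDl.
near=> y; have Ky : K y by near: y; exact: withinT.
apply: (le_lt_trans (gC _ _ Kx Ky)).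
apply: (@le_lt_trans _ _ (M * `|x - y|)).
  by rewrite ler_wpM2r// (le_trans (ler_norm C))// lerDl.
rewrite mulrC -ltr_pdivlMr//; near: y; apply: cvg_within.
have /cvgrPdist_lt : (id : 'cV[R]_n -> 'cV[R]_n) @ x --> x by exact: cvg_id.
by apply; rewrite divr_gt0.
Unshelve. all: by end_near. Qed.

Lemma is_norm_continuous (R : realType) (n : nat) (N : 'cV[R]_n -> R) :
  is_norm N -> continuous N.
Proof.
move=> N_norm; have [C C0 NC] := is_norm_le_mx_norm N_norm.
apply/continuous_subspace_setT.
apply: (@lipschitz_on_within_continuous _ _ _ _ C) => x y _ _.
apply: le_trans (NC _); rewrite ler_norml.
have := is_norm_distD N_norm y x 0; have := is_norm_distD N_norm x y 0.
by rewrite !subr0 (is_norm_distC N_norm y x) => *; lra.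
Qed.

(** Heine-Borel for row vectors, carried over by transposition, which is continuous and does not
    increase the maximum norm. *)
Lemma bounded_closed_compact_cV (R : realType) (n : nat) (K : set 'cV[R]_n) :
  bounded_set K -> closed K -> compact K.
Proof.
move=> Kb Kc.
have trC m p : continuous (@trmx R m p).
  move=> x; apply/(@cvgrPdist_le R _ _ (nbhs x)) => e e0; near=> y.
  rewrite [leLHS]/Num.norm /= mx_normrE; apply/bigmax_leP; split=> [|[i j] _].
    exact: ltW.
  rewrite -linearB mxE; apply: le_trans (le_coord_mx_norm _ _ _) _.
  near: y.
  have /cvgrPdist_le : (id : 'M[R]_(m, p) -> _) @ x --> x by exact: cvg_id.
  exact.
have -> : K = trmx @` (trmx @^-1` K : set 'rV[R]_n).
  rewrite eqEsubset; split=> [x Kx|_ [x Kx <-]] //.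
  by exists x^T; rewrite /= trmxK.
apply: continuous_compact; first by apply: continuous_subspaceT; exact: trC.
apply: bounded_closed_compact; last first.
  by apply: preimage_closed => // x _; exact: trC.
have [M [Mr KM]] := Kb; exists M; split=> // a Ma x /= Kx.
have := KM _ Ma _ Kx; apply: le_trans.
rewrite [leLHS]/Num.norm /= mx_normrE; apply/bigmax_leP; split=> // -[i j] _.
by have := le_coord_mx_norm x^T j i; rewrite mxE.
Unshelve. all: by end_near. Qed.

(** By compactness [N] attains a minimum on the unit sphere of the maximum norm. The minimum is
    positive since [N] vanishes only at 0, and homogeneity extends the bound to all vectors with its
    inverse as constant. *)
Lemma mx_norm_le_is_norm (R : realType) (n : nat) (N : 'cV[R]_n -> R) :
  is_norm N -> exists2 C, 0 < C & forall x, `|x| <= C * N x.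
Proof.
move=> N_norm; have [N0 NZ _] := N_norm.
have Nge0 := is_norm_ge0 N_norm.
pose S := [set x : 'cV[R]_n | `|x| = 1].
(* The sphere is empty when [n = 0]; then every vector is zero. *)
have [S0|/set0P S0] := eqVneq S set0.
  exists 1 => // x; have [->|x0] := eqVneq x 0; first by rewrite normr0 mul1r.
  have : S (`|x|^-1 *: x) by rewrite /S /= normrZ normfV normr_id mulVf// normr_eq0.
  by rewrite S0.
have Sc : compact S.
  apply: bounded_closed_compact_cV.
    by exists 1; split=> // a /ltW a1 x /= ->.
  apply: (@preimage_closed _ _ (@Num.norm R _) [set 1]); last exact: closed_eq.
  by move=> x _; exact: norm_continuous.
have [c /set_mem cS cmin] := compact_EVT_min S0 Sc
  (continuous_subspaceT (is_norm_continuous N_norm)).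
have c_neq0 : c != 0 by rewrite -normr_eq0 cS oner_eq0.
have Nc : 0 < N c by rewrite lt0r Nge0 andbT; apply: contra_neq c_neq0 => /N0.
exists (N c)^-1; first by rewrite invr_gt0.
move=> x; have [->|x0] := eqVneq x 0.
  by rewrite normr0 mulr_ge0// invr_ge0 ltW.
rewrite mulrC ler_pdivlMr// mulrC -ler_pdivlMr ?normr_gt0//.
rewrite -[`|x|]normr_id [leRHS]mulrC -normfV -NZ; apply/cmin/mem_set.
by rewrite /S /= normrZ normfV normr_id mulVf// normr_eq0.
Qed.

(** * The induced matrix norm *)

(** Makes the [sup] in [induced_norm] a genuine upper bound. On the unit ball of [N] all coordinates
    are at most [D], so each entry of [M *m y] is at most [n] times [|M| * D]. *)
Lemma induced_norm_has_ubound (R : realType) (n : nat) (N : 'cV[R]_n -> R)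
    (M : 'M[R]_n) :
  is_norm N -> has_ubound [set N (M *m x) | x in [set x | N x <= 1]].
Proof.
move=> N_norm.
have [C C0 NC] := is_norm_le_mx_norm N_norm.
have [D D0 ND] := mx_norm_le_is_norm N_norm.
exists (C * (`|M| * D *+ n)) => _ [y /= y1 <-].
apply: le_trans (NC _) _; rewrite ler_pM2l//.
rewrite [leLHS]/Num.norm /= mx_normrE; apply/bigmax_leP; split=> [|[i j] _] /=.
  by rewrite mulrn_wge0// mulr_ge0// ltW.
rewrite mxE; apply: le_trans (ler_norm_sum _ _ _) _.
have <- : \sum_(k < n) `|M| * D = `|M| * D *+ n.
  by rewrite sumr_const card_ord.
apply: ler_sum => k _.
rewrite normrM ler_pM ?le_coord_mx_norm//.
apply: le_trans (le_coord_mx_norm _ _ _) _; apply: le_trans (ND _) _.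
by rewrite -[leRHS]mulr1 ler_pM2l.
Qed.

Lemma induced_norm_ge0 (R : realType) (n : nat) (N : 'cV[R]_n -> R)
    (M : 'M[R]_n) :
  is_norm N -> 0 <= induced_norm N M.
Proof.
move=> N_norm; apply: ub_le_sup; first exact: induced_norm_has_ubound.
by exists 0; rewrite /= ?mulmx0 (is_norm0 N_norm).
Qed.

Lemma is_norm_mulmx_le (R : realType) (n : nat) (N : 'cV[R]_n -> R)
    (M : 'M[R]_n) (x : 'cV[R]_n) :
  is_norm N -> N (M *m x) <= induced_norm N M * N x.
Proof.
move=> N_norm; have [N0 NZ _] := N_norm; have Nge0 := is_norm_ge0 N_norm.
have [->|x0] := eqVneq x 0; first by rewrite mulmx0 (is_norm0 N_norm) mulr0.
have Nx : 0 < N x by rewrite lt0r Nge0 andbT; apply: contra_neq x0 => /N0.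
rewrite -ler_pdivrMr// mulrC -(ger0_norm (Nge0 x)) -normfV -NZ scalemxAr.
apply: ub_le_sup; first exact: induced_norm_has_ubound.
exists ((N x)^-1 *: x) => //=.
by rewrite NZ normfV ger0_norm// mulVf// gt_eqF.
Qed.

(** * Fixed points of contractions *)

(** [L] may be negative, for instance when [Omega] is a singleton. A nonnegative constant lets later
    estimates multiply inequalities by it. *)
Lemma lipschitz_wrt_ge0_const (R : realType) (n : nat) (N : 'cV[R]_n -> R) (L : R)
    (Omega : set 'cV[R]_n) (f : 'cV[R]_n -> 'cV[R]_n) :
  is_norm N -> L < 1 -> lipschitz_wrt N L Omega f ->
  exists q, [/\ 0 <= q, q < 1 & lipschitz_wrt N q Omega f].
Proof.
move=> N_norm L1 fL; exists (Num.max 0 L); split.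
- by rewrite le_max lexx.
- by rewrite gt_max ltr01.
- move=> x y Ox Oy; apply: le_trans (fL _ _ Ox Oy) _.
  by rewrite ler_wpM2r ?is_norm_ge0// le_max lexx orbT.
Qed.

(* The displacement [N (x - f x)] attains its minimum on a large enough ball of
   Omega around [x0], and applying [f] to a minimiser shrinks it by [q]. *)
Lemma contraction_fixpoint (R : realType) (n : nat) (N : 'cV[R]_n -> R) (q : R)
    (Omega : set 'cV[R]_n) (f : 'cV[R]_n -> 'cV[R]_n) :
  is_norm N -> closed Omega -> Omega !=set0 ->
  (forall x, Omega x -> Omega (f x)) ->
  0 <= q -> q < 1 -> lipschitz_wrt N q Omega f ->
  exists2 x, Omega x & f x = x.
Proof.
move=> N_norm Oc [x0 Ox0] fO q0 q1 fq.
have Nge0 := is_norm_ge0 N_norm.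
have [C C0 NC] := is_norm_le_mx_norm N_norm.
have [D D0 ND] := mx_norm_le_is_norm N_norm.
(* The radius solves [q * r + N (x0 - f x0) = r], which is what makes [f] map the ball [K] into
   itself. *)
pose r := N (x0 - f x0) / (1 - q).
pose K := Omega `&` [set x | N (x - x0) <= r].
have K0 : K x0.
  split=> //=; rewrite subrr (is_norm0 N_norm) divr_ge0// subr_ge0; exact: ltW.
have fK x : K x -> K (f x).
  move=> [Ox /= xr]; split; first exact: fO.
  have := is_norm_distD N_norm (f x0) (f x) x0; have := fq _ _ Ox Ox0.
  have : q * N (x - x0) <= q * r by rewrite ler_wpM2l.
  have rE : r * (1 - q) = N (x0 - f x0) by rewrite divfK// subr_eq0 gt_eqF.
  by rewrite (is_norm_distC N_norm (f x0) x0) /= => *; lra.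
have Kc : compact K.
  apply: bounded_closed_compact_cV.
    exists (D * r + `|x0|); split; first exact: num_real.
    move=> a /ltW ra x [_ /= xr]; apply: le_trans ra.
    rewrite -[x in leLHS](subrK x0); apply: le_trans (ler_normD _ _) _.
    by rewrite lerD2r (le_trans (ND _))// ler_pM2l.
  have -> : K = Omega `&` (fun x => N (x - x0)) @^-1` [set y | y <= r] by [].
  have ctr : continuous (fun x : 'cV[R]_n => N (x - x0)).
    move=> x; apply: (@continuous_cvg _ _ _ (nbhs x) _ (fun y : 'cV[R]_n => y - x0) N).
      exact: is_norm_continuous.
    by apply: (@cvgB _ _ _ (nbhs x)); [exact: cvg_id|exact: cvg_cst].
  apply: closedI => //; apply: preimage_closed; last exact: closed_le.
  by move=> x _; exact: ctr.
pose g x := N (x - f x).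
have gC : {within K, continuous g}.
  (* Replacing [x] by [y] moves both ends of the displacement, by at most [(1 + q) * N (x - y)] in
     total, and [1 + q] is below 2. *)
  apply: (@lipschitz_on_within_continuous _ _ _ _ (2 * C)) => x y [Ox _] [Oy _].
  have Nxy := NC (x - y).
  have := fq _ _ Ox Oy.
  have : q * N (x - y) <= N (x - y) by rewrite ler_piMl// ltW.
  have := is_norm_distD N_norm y x (f x).
  have := is_norm_distD N_norm (f y) y (f x).
  have := is_norm_distD N_norm x y (f y).
  have := is_norm_distD N_norm (f x) x (f y).
  rewrite /g (is_norm_distC N_norm y x) (is_norm_distC N_norm (f y) (f x)) => *.
  by rewrite ler_norml; lra.
have [c /set_mem Kcc cmin] := compact_EVT_min (ex_intro _ _ K0) Kc gC.
have [Oc' _] := Kcc; exists c => //; apply/esym/(is_norm_eq N_norm).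
have := cmin _ (mem_set (fK _ Kcc)); have := fq _ _ Oc' (fO _ Oc').
rewrite /g => *; have : (1 - q) * N (c - f c) <= 0 by lra.
by rewrite pmulr_rle0// subr_gt0.
Qed.

Lemma contraction_fixpoint_unique (R : realType) (n : nat)
    (N : 'cV[R]_n -> R) (L : R) (Omega : set 'cV[R]_n)
    (f : 'cV[R]_n -> 'cV[R]_n) x y :
  is_norm N -> L < 1 -> lipschitz_wrt N L Omega f ->
  Omega x -> Omega y -> f x = x -> f y = y -> x = y.
Proof.
move=> N_norm L1 fL Ox Oy fx fy; apply: (is_norm_eq N_norm).
have := fL _ _ Ox Oy; rewrite fx fy => *.
have : (1 - L) * N (x - y) <= 0 by lra.
by rewrite pmulr_rle0// subr_gt0.
Qed.

(** * The inexact Picard iteration *)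

Lemma inexact_step_displacement_le (R : realType) (n : nat)
    (N : 'cV[R]_n -> R) (M : 'M[R]_n) (b x y : 'cV[R]_n) (tau : R) :
  is_norm N -> M \in unitmx -> tau < 1 ->
  N (M *m y - b) <= tau * N (M *m x - b) ->
  N (x - invmx M *m b) <= cond_number N M / (1 - tau) * N (y - x).
Proof.
move=> N_norm Mu t1 res.
have I0 := induced_norm_ge0 (invmx M) N_norm.
have resE z : M *m (z - invmx M *m b) = M *m z - b.
  by rewrite mulmxBr mulmxA mulmxV// mul1mx.
(* Going from [M *m x] to [b] through [M *m y], the criterion bounds the second leg by [tau] times
   the left-hand side itself; absorbing it leaves the factor [1 - tau]. *)
have Mx : N (M *m x - b) <= induced_norm N M / (1 - tau) * N (y - x).
  rewrite mulrAC ler_pdivlMr ?subr_gt0//.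
  have := is_norm_distD N_norm (M *m y) (M *m x) b.
  have := is_norm_mulmx_le M (y - x) N_norm.
  by rewrite mulmxBr (is_norm_distC N_norm (M *m y) (M *m x)) => *; lra.
rewrite -[x - _]mul1mx -(mulVmx Mu) -mulmxA resE.
apply: le_trans (is_norm_mulmx_le _ _ N_norm) _.
rewrite /cond_number mulrC.
by rewrite [leRHS](_ : _ = induced_norm N M / (1 - tau) * N (y - x) *
  induced_norm N (invmx M)) ?ler_wpM2r//; ring.
Qed.

Lemma inexact_picard_limit_fixpoint (R : realType) (n : nat)
    (N : 'cV[R]_n -> R) (Omega : set 'cV[R]_n) (b : 'cV[R]_n)
    (A : 'cV[R]_n -> 'M[R]_n) (q tau : R)
    (x : nat -> 'cV[R]_n) (xeps : 'cV[R]_n) :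
  is_norm N -> closed Omega ->
  (forall x, Omega x -> A x \in unitmx) ->
  0 <= q -> lipschitz_wrt N q Omega (picard A b) ->
  [bounded cond_number N (A x) | x in Omega] ->
  tau < 1 -> (forall k, Omega (x k)) -> inexact_picard_seq N A b tau x ->
  x @ \oo --> xeps -> Omega xeps /\ picard A b xeps = xeps.
Proof.
move=> N_norm Oc Au q0 fq [M0 [_ /(_ (`|M0| + 1))]] M0b t1 Ox xN xeps_lim.
have Nge0 := is_norm_ge0 N_norm.
have Oxeps : Omega xeps by apply: closed_cvg xeps_lim => //; exact: nearW.
split=> //; apply/esym/(is_norm_eq N_norm).
set f := picard A b in fq *.
(* Boundedness provides a bound on the condition number by any real above [M0]; [|M0| + 1] is such a
   real and is nonnegative. *)
pose kappa := (`|M0| + 1) / (1 - tau).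
have k0 : 0 <= kappa by apply: divr_ge0; [exact: addr_ge0|rewrite subr_ge0 ltW].
(* Go from [xeps] to [f xeps] through [x k] and [f (x k)]. The legs contribute 1, the displacement
   of [x k], and [q]; the step [x k.+1 - x k] in that displacement is split at [xeps], giving
   [kappa] twice. *)
have disp k : N (xeps - f xeps) <=
    (1 + q + kappa) * N (xeps - x k) + kappa * N (xeps - x k.+1).
  have step : N (x k - f (x k)) <= kappa * N (x k.+1 - x k).
    apply: le_trans (inexact_step_displacement_le N_norm (Au _ (Ox k)) t1 (xN k)) _.
    rewrite ler_wpM2r// ler_pM2r ?invr_gt0 ?subr_gt0//.
    apply: le_trans (ler_norm _) _; apply: M0b (Ox k).
    by rewrite (le_lt_trans (ler_norm M0))// ltrDl.
  have := ler_wpM2l k0 (is_norm_distD N_norm xeps (x k.+1) (x k)).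
  have := is_norm_distD N_norm (x k) xeps (f xeps).
  have := is_norm_distD N_norm (f (x k)) (x k) (f xeps).
  have := fq _ _ (Ox k) Oxeps.
  rewrite (is_norm_distC N_norm (x k.+1) xeps) (is_norm_distC N_norm (x k) xeps).
  by move=> *; lra.
have lim0 : (fun k => N (xeps - x k)) @ \oo --> (0 : R).
  rewrite -(is_norm0 N_norm) -(subrr xeps).
  apply: continuous_cvg; first exact: is_norm_continuous.
  by apply: cvgB => //; exact: cvg_cst.
have lim1 : (fun k => N (xeps - x k.+1)) @ \oo --> (0 : R).
  by rewrite (cvg_shiftS (fun k => N (xeps - x k))).
suff : (fun k => (1 + q + kappa) * N (xeps - x k) +
    kappa * N (xeps - x k.+1)) @ \oo --> (0 : R).
  (* The left side of [disp] does not depend on [k], so it is at most the limit 0. *)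
  by move=> /cvgr_to_ge; apply; apply: nearW.
rewrite -[0]addr0 -[X in _ --> X + _](mulr0 (1 + q + kappa)).
rewrite -[X in _ --> _ + X](mulr0 kappa).
by apply: cvgD; apply: cvgMr.
Qed.

Theorem theorem3 (R : realType) (n : nat) (N : 'cV[R]_n -> R)
    (Omega : set 'cV[R]_n) (b : 'cV[R]_n) (A : 'cV[R]_n -> 'M[R]_n) (L : R)
    (N_norm : is_norm N)
    (Omega_closed : closed Omega)
    (Omega_neq0 : Omega !=set0)
    (A_inv : forall x, Omega x -> A x \in unitmx)
    (picard_Omega : forall x, Omega x -> Omega (picard A b x))
    (L_lt1 : L < 1)
    (picard_lip : lipschitz_wrt N L Omega (picard A b))
    (cond_bounded : [bounded cond_number N (A x) | x in Omega]) :
  exists xstar : 'cV[R]_n,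
    [/\ Omega xstar,
        picard A b xstar = xstar,
        forall y, Omega y -> picard A b y = y -> y = xstar
      & forall (tau : R) (x : nat -> 'cV[R]_n) (xeps : 'cV[R]_n),
          0 < tau -> tau < 1 ->
          (forall k, Omega (x k)) ->
          inexact_picard_seq N A b tau x ->
          x @ \oo --> xeps ->
          xeps = xstar].

Proof.
have [q [q0 q1 fq]] := lipschitz_wrt_ge0_const N_norm L_lt1 picard_lip.
have [xs Oxs fxs] :=
  contraction_fixpoint N_norm Omega_closed Omega_neq0 picard_Omega q0 q1 fq.
(* The fixed point is chosen before [tau] and the sequence are introduced, so the limit is the same
   for every tolerance. *)
exists xs; split=> // [y Oy fy|tau x xeps _ t1 Ox xN xlim].
  exact: contraction_fixpoint_unique N_norm L_lt1 picard_lip Oy Oxs fy fxs.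
have [Oxeps fxeps] := inexact_picard_limit_fixpoint N_norm Omega_closed A_inv
  q0 fq cond_bounded t1 Ox xN xlim.
exact: contraction_fixpoint_unique N_norm L_lt1 picard_lip Oxeps Oxs fxeps fxs.
Qed.
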